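(* Let $\alpha,\beta\in\mathcal{L}$ and let $P:\mathcal{L}\to[0,1]$ be any $\mathbf{mb}^\bigstar$-probability function. Then $$P(\beta)=P(\beta\land\alpha)+P(\beta\land\neg\alpha)+P(\beta\land\bigstar\alpha)-P\big((\beta\land(\alpha\lor\neg\alpha))\land\bigstar\alpha\big).$$
   Context: Let $V$ be a denumerable set of propositional variables and let $\mathcal{L}$ be the set of formulas generated freely from $V$ by the binary connectives $\land,\lor,\longrightarrow$ and the unary connectives $\neg,\bigstar$. The logic $\mathbf{mb}^\bigstar=\langle\mathcal{L},\vdash\rangle$ is given by the Hilbert-style system with the following axiom schemas (for all $\alpha,\beta,\gamma\in\mathcal{L}$): (1) $\alpha\longrightarrow(\beta\longrightarrow\alpha)$; (2) $(\alpha\longrightarrow\beta)\longrightarrow((\alpha\longrightarrow(\beta\longrightarrow\gamma))\longrightarrow(\alpha\longrightarrow\gamma))$; (3) $\alpha\longrightarrow(\beta\longrightarrow(\alpha\land\beta))$; (4) $(\alpha\land\beta)\longrightarrow\alpha$; (5) $(\alpha\land\beta)\longrightarrow\beta$; (6) $\alpha\longrightarrow(\alpha\lor\beta)$; (7) $\beta\longrightarrow(\alpha\lor\beta)$; (8) $(\alpha\longrightarrow\gamma)\longrightarrow((\beta\longrightarrow\gamma)\longrightarrow((\alpha\lor\beta)\longrightarrow\gamma))$; (9) $\alpha\lor(\alpha\longrightarrow\beta)$; (10) $\alpha\longrightarrow(\neg\alpha\longrightarrow\beta)$; (11) $(\alpha\lor\neg\alpha)\lor\bigstar\alpha$; and the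 single inference rule modus ponens (from $\alpha$ and $\alpha\longrightarrow\beta$ infer $\beta$). For $\Gamma\cup\{\varphi\}\subseteq\mathcal{L}$, $\Gamma\vdash\varphi$ means there is a finite sequence of formulas ending in $\varphi$, each of which is an axiom instance, an element of $\Gamma$, or obtained from two earlier members by modus ponens. We write $\vdash\varphi$ for $\emptyset\vdash\varphi$ and $\psi\vdash\varphi$ for $\{\psi\}\vdash\varphi$. An $\mathbf{mb}^\bigstar$-probability function is a function $P:\mathcal{L}\to[0,1]$ such that for all $\varphi,\psi\in\mathcal{L}$: (i) if $\vdash\varphi$ then $P(\varphi)=1$; (ii) if $\varphi\vdash\chi$ for all $\chi\in\mathcal{L}$, then $P(\varphi)=0$; (iii) if $\psi\vdash\varphi$ then $P(\psi)\le P(\varphi)$; (iv) $P(\varphi\lor\psi)=P(\varphi)+P(\psi)-P(\varphi\land\psi)$. *)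

(* Defs.v *)
From Stdlib Require Import Reals List Ensembles FinFun.

Set Implicit Arguments.
Unset Strict Implicit.

Definition denumerable (V : Type) : Prop :=
  exists f : nat -> V, Bijective f.

Inductive form (V : Type) : Type :=
| Var (v : V)
| And (a b : form V)
| Or (a b : form V)
| Imp (a b : form V)
| Neg (a : form V)
| Star (a : form V).

Declare Scope form_scope.
Delimit Scope form_scope with form.
Bind Scope form_scope with form.
Notation "a /\ b" := (And a b) : form_scope.
Notation "a \/ b" := (Or a b) : form_scope.
Notation "~ a" := (Neg a) : form_scope.
Notation "★ a" := (Star a) (at level 75, right associativity) : form_scope.
Notation "a --> b" := (Imp a b) (at level 90, right associativity) : form_scope.

Inductive mb_axiom (V : Type) : form V -> Prop :=
| Ax1 a b : mb_axiom (a --> (b --> a))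
| Ax2 a b c : mb_axiom ((a --> b) --> ((a --> (b --> c)) --> (a --> c)))
| Ax3 a b : mb_axiom (a --> (b --> (a /\ b)))
| Ax4 a b : mb_axiom ((a /\ b) --> a)
| Ax5 a b : mb_axiom ((a /\ b) --> b)
| Ax6 a b : mb_axiom (a --> (a \/ b))
| Ax7 a b : mb_axiom (b --> (a \/ b))
| Ax8 a b c : mb_axiom ((a --> c) --> ((b --> c) --> ((a \/ b) --> c)))
| Ax9 a b : mb_axiom (a \/ (a --> b))
| Ax10 a b : mb_axiom (a --> ((~ a) --> b))
| Ax11 a : mb_axiom ((a \/ (~ a)) \/ (★ a)).

Definition derivation (V : Type) (G : Ensemble (form V))
    (s : list (form V)) : Prop :=
  forall s1 a s2, s = s1 ++ a :: s2 ->
    mb_axiom a \/ In _ G a \/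
    exists b, List.In b s1 /\ List.In (b --> a)%form s1.

Definition derives (V : Type) (G : Ensemble (form V)) (a : form V) : Prop :=
  exists s, derivation G (s ++ a :: nil).

Record mb_probability (V : Type) (P : form V -> R) : Prop := {
  mb_prob_range : forall a, (0 <= P a <= 1)%R;
  mb_prob_thm : forall a, derives (Empty_set _) a -> P a = 1%R;
  mb_prob_bot : forall a,
    (forall c, derives (Singleton _ a) c) -> P a = 0%R;
  mb_prob_mono : forall a b, derives (Singleton _ b) a -> (P b <= P a)%R;
  mb_prob_or : forall a b, P (a \/ b)%form = (P a + P b - P (a /\ b)%form)%R
}.

(* Main.v *)
(** Distributing beta over the theorem (alpha \/ ~alpha) \/ ★alpha, and then
    over alpha \/ ~alpha, writes beta as a disjunction up to interderivability;
    additivity is applied at both steps, and the overlap of beta /\ alpha and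
    beta /\ ~alpha is explosive by Ax10, so it has probability 0.  Distributivity
    only needs modus ponens and transitivity of the implication, so the deduction
    theorem is avoided. *)

Require Import Defs.
From Stdlib Require Import Reals List Ensembles Lra.
Import ListNotations.

Section Derivability.

Variable V : Type.
Implicit Types (G : Ensemble (form V)) (a b c x y : form V).

Lemma derivation_nil G : derivation G [].
Proof. intros [|] a s2 H; discriminate. Qed.

Lemma derivation_rcons G s a :
  derivation G s ->
  (mb_axiom a \/ In _ G a \/
   exists b, List.In b s /\ List.In (b --> a)%form s) ->
  derivation G (s ++ [a]).
Proof.
  intros Hs Ha s1 x s2 H.
  (* Rereading [x :: s2] from its right end identifies its last element with [a]. If nothing
     precedes it, [x] is [a] itself; otherwise [x] already lies in [s]. *)
  destruct (exists_last (l := x :: s2)) as [t [z Hz]]; [discriminate|].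
  rewrite Hz, app_assoc in H.
  apply app_inj_tail in H as [H ->].
  destruct t as [|w t]; simpl in Hz; injection Hz as -> _.
  - now rewrite app_nil_r in H; subst.
  - now apply (Hs s1 w t).
Qed.

(** A justification only looks back at earlier members, so putting [s] in front keeps it valid.
    Induction from the right fits, as prefixes of derivations are derivations. *)
Lemma derivation_app G s t :
  derivation G s -> derivation G t -> derivation G (s ++ t).
Proof.
  intros Hs; induction t as [|a t IH] using rev_ind; intros Ht.
  - now rewrite app_nil_r.
  - rewrite app_assoc; apply derivation_rcons.
    + apply IH; intros s1 x s2 E; apply (Ht s1 x (s2 ++ [a])).
      now rewrite E, <- app_assoc.
    + destruct (Ht t a [] eq_refl) as [H|[H|[b [H1 H2]]]]; auto.
      right; right; exists b; rewrite !in_app_iff; auto.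
Qed.

Lemma derives_axiom G a : mb_axiom a -> derives G a.
Proof.
  intros H; exists []; apply derivation_rcons; [apply derivation_nil|auto].
Qed.

Lemma derives_hyp a : derives (Singleton _ a) a.
Proof.
  exists []; apply derivation_rcons; [apply derivation_nil|].
  right; left; constructor.
Qed.

Lemma derives_mp G a b :
  derives G a -> derives G (a --> b)%form -> derives G b.
Proof.
  intros [s Hs] [t Ht]; exists ((s ++ [a]) ++ t ++ [(a --> b)%form]).
  apply derivation_rcons; [now apply derivation_app|].
  right; right; exists a; rewrite !in_app_iff; simpl; auto.
Qed.

(** [Ax1] weakens [b --> c] to [a --> (b --> c)], which [Ax2] combines with [a --> b]. *)
Lemma derives_imp_trans G a b c :
  derives G (a --> b)%form -> derives G (b --> c)%form ->
  derives G (a --> c)%form.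
Proof.
  intros Hab Hbc.
  apply derives_mp with (1 := derives_mp _ _ _ Hbc (derives_axiom _ _ (Ax1 _ a))).
  exact (derives_mp _ _ _ Hab (derives_axiom _ _ (Ax2 _ _ _))).
Qed.

Lemma derives_and G a b :
  derives G a -> derives G b -> derives G (a /\ b)%form.
Proof.
  intros Ha Hb; apply derives_mp with (1 := Hb).
  exact (derives_mp _ _ _ Ha (derives_axiom _ _ (Ax3 _ _))).
Qed.

Lemma derives_and_l G a b : derives G (a /\ b)%form -> derives G a.
Proof. intros H; exact (derives_mp _ _ _ H (derives_axiom _ _ (Ax4 _ _))). Qed.

Lemma derives_and_r G a b : derives G (a /\ b)%form -> derives G b.
Proof. intros H; exact (derives_mp _ _ _ H (derives_axiom _ _ (Ax5 _ _))). Qed.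

Lemma derives_or_elim G a b c :
  derives G (a \/ b)%form ->
  derives G (a --> c)%form -> derives G (b --> c)%form -> derives G c.
Proof.
  intros H Ha Hb; apply derives_mp with (1 := H); apply derives_mp with (1 := Hb).
  exact (derives_mp _ _ _ Ha (derives_axiom _ _ (Ax8 _ _ _))).
Qed.

Lemma derives_explosion G a c :
  derives G a -> derives G (~ a)%form -> derives G c.
Proof.
  intros Ha Hn; apply derives_mp with (1 := Hn).
  exact (derives_mp _ _ _ Ha (derives_axiom _ _ (Ax10 _ _))).
Qed.

(** Since [b] is derived outright, one modus ponens on [Ax3] gives [x --> (b /\ x)], and likewise
    for [y]; both branches are then implications, as [Ax8] demands. *)
Lemma derives_and_or_distr G b x y :
  derives G b -> derives G (x \/ y)%form ->
  derives G ((b /\ x) \/ (b /\ y))%form.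
Proof.
  intros Hb H; apply derives_or_elim with (1 := H).
  - apply derives_imp_trans with (b /\ x)%form.
    + exact (derives_mp _ _ _ Hb (derives_axiom _ _ (Ax3 _ _))).
    + apply derives_axiom, Ax6.
  - apply derives_imp_trans with (b /\ y)%form.
    + exact (derives_mp _ _ _ Hb (derives_axiom _ _ (Ax3 _ _))).
    + apply derives_axiom, Ax7.
Qed.

Lemma derives_and_or_factor G b x y :
  derives G ((b /\ x) \/ (b /\ y))%form -> derives G (b /\ (x \/ y))%form.
Proof.
  intros H; apply derives_and; apply derives_or_elim with (1 := H).
  - apply derives_axiom, Ax4.
  - apply derives_axiom, Ax4.
  - apply derives_imp_trans with x; apply derives_axiom; constructor.
  - apply derives_imp_trans with y; apply derives_axiom; constructor.
Qed.

End Derivability.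

Lemma mb_prob_equiv (V : Type) (P : form V -> R) (a b : form V) :
  mb_probability P ->
  derives (Singleton _ a) b -> derives (Singleton _ b) a -> P a = P b.
Proof. intros hP Hab Hba; apply Rle_antisym; now apply mb_prob_mono. Qed.

(** Additivity after distributing. The overlap is stated with [b] only once, which makes it the
    subtracted term of the final identity when [y] is [★ alpha]. *)
Lemma mb_prob_and_or (V : Type) (P : form V -> R) (b x y : form V) :
  mb_probability P ->
  (P (b /\ (x \/ y))%form =
     P (b /\ x)%form + P (b /\ y)%form - P ((b /\ x) /\ y)%form)%R.
Proof.
  intros hP.
  rewrite (mb_prob_equiv V P _ ((b /\ x) \/ (b /\ y))%form hP).
  - rewrite (mb_prob_or hP).
    rewrite (mb_prob_equiv V P ((b /\ x) /\ (b /\ y))%form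
               ((b /\ x) /\ y)%form hP); [reflexivity| |].
    + apply derives_and.
      * exact (derives_and_l _ _ _ _ (derives_hyp _ _)).
      * exact (derives_and_r _ _ _ _ (derives_and_r _ _ _ _ (derives_hyp _ _))).
    + pose proof (derives_hyp V ((b /\ x) /\ y)%form) as H.
      pose proof (derives_and_l _ _ _ _ H) as Hbx.
      apply derives_and; [exact Hbx|].
      apply derives_and; [exact (derives_and_l _ _ _ _ Hbx)|].
      exact (derives_and_r _ _ _ _ H).
  - pose proof (derives_hyp V (b /\ (x \/ y))%form) as H.
    apply derives_and_or_distr.
    + exact (derives_and_l _ _ _ _ H).
    + exact (derives_and_r _ _ _ _ H).
  - apply derives_and_or_factor, derives_hyp.
Qed.

Theorem theorem3p7 (V : Type) (hV : denumerable V)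
    (alpha beta : form V) (P : form V -> R) (hP : mb_probability P) :
  (P beta =
     P (beta /\ alpha)%form + P (beta /\ ~ alpha)%form
     + P (beta /\ ★ alpha)%form
     - P ((beta /\ (alpha \/ ~ alpha)) /\ ★ alpha)%form)%R.
Proof.
  rewrite (mb_prob_equiv V P beta
             (beta /\ ((alpha \/ ~ alpha) \/ ★ alpha))%form hP).
  (* The outer disjunction is split first, then [alpha \/ ~ alpha] in the first summand. *)
  - rewrite (mb_prob_and_or V P beta (alpha \/ ~ alpha)%form), mb_prob_and_or by exact hP.
    rewrite (mb_prob_bot hP (a := ((beta /\ alpha) /\ ~ alpha)%form)); [lra|].
    intros c; pose proof (derives_hyp V ((beta /\ alpha) /\ ~ alpha)%form) as H.
    apply derives_explosion with alpha.
    + exact (derives_and_r _ _ _ _ (derives_and_l _ _ _ _ H)).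
    + exact (derives_and_r _ _ _ _ H).
  (* The added conjunct is an instance of [Ax11], so it comes for free. *)
  - apply derives_and; [apply derives_hyp|apply derives_axiom, Ax11].
  - exact (derives_and_l _ _ _ _ (derives_hyp _ _)).
Qed.
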